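(* Let $n\ge2$, $k\ge1$, and let $\mathcal M^n\subset\mathbb R^{n+k}$ be an immersed submanifold whose second fundamental form $h$ satisfies, at every point, $$|h|^2-\frac1{n-1}|H|^2\le-\varepsilon|H|^2$$ for some $\varepsilon>0$. Then the curvature operator $\mathcal R$ of $\mathcal M$ satisfies $$\mathcal R\ge\frac{\varepsilon}{2}|H|^2 I,$$ i.e. $\mathcal R(\omega,\omega)\ge\frac\varepsilon2|H|^2|\omega|^2$ for every $p\in\mathcal M$ and every $\omega\in\bigwedge^2T_p\mathcal M$.
   Context: The second fundamental form $h$ is the symmetric normal-bundle-valued 2-tensor with components $h_{ij\alpha}$ in local orthonormal frames $\{e_i\}$ of the tangent bundle and $\{\nu_\alpha\}$ of the normal bundle; $H=\operatorname{tr}_gh=\sum_{i,\alpha}h_{ii\alpha}\nu_\alpha$ is the mean curvature vector, and $|h|^2=\sum_{i,j,\alpha}h_{ij\alpha}^2$. The curvature operator $\mathcal R$ of the induced metric is regarded as the symmetric bilinear form on $\bigwedge^2T_p\mathcal M$ determined by $\mathcal R(e_i\wedge e_j,e_k\wedge e_l)=R_{ijkl}$, with the sign convention for which the Gauss equation reads $R_{ijkl}=\sum_\alpha(h_{ik\alpha}h_{jl\alpha}-h_{jk\alpha}h_{il\alpha})$ (so $\mathcal R(e_i\wedge e_j,e_i\wedge e_j)$ is the sectional curvature of the plane spanned by orthonormal $e_i,e_j$). The inner product on $\bigwedge^2T_p\mathcal M$ is the one for which $\{e_i\wedge e_j\}_{i<j}$ is orthonormal whenever $\{e_i\}$ is orthonormal,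 and $I$ is the corresponding identity. *)

(* Defs.v *)
From HB Require Import structures.
From mathcomp Require Import all_boot all_order all_algebra.
From mathcomp Require Import all_classical all_reals all_analysis.
From mathcomp Require Import ring lra.

Set Implicit Arguments.
Unset Strict Implicit.
Unset Printing Implicit Defensive.

Import Order.TTheory GRing.Theory Num.Theory numFieldNormedType.Exports.
Local Open Scope classical_set_scope.
Local Open Scope ring_scope.

Definition partial {R : realType} {n : nat} {W : normedModType R} (i : 'I_n)
    (f : 'rV[R]_n -> W) (x : 'rV[R]_n) : W :=
  'D_(delta_mx 0 i) f x.

Fixpoint Ck_on {R : realType} {n : nat} {W : normedModType R} (r : nat)
    (U : set 'rV[R]_n) (f : 'rV[R]_n -> W) : Prop :=
  if r is r'.+1 then
    (forall x, U x -> differentiable f x) /\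
    (forall i : 'I_n, Ck_on r' U (partial i f))
  else forall x, U x -> {for x, continuous f}.

(* Meant for open U. *)
Definition smooth_on {R : realType} {n : nat} {W : normedModType R}
    (U : set 'rV[R]_n) (f : 'rV[R]_n -> W) : Prop :=
  forall r, Ck_on r U f.

(* The functions chart_coord and chart_param are total; only their values on
   chart_dom a and on chart_coord a @` chart_dom a, respectively, matter. *)
Record smooth_manifold (R : realType) (n : nat) := SmoothManifold {
  carrier :> topologicalType ;
  carrier_hausdorff : hausdorff_space carrier ;
  carrier_second_countable : @second_countable carrier ;
  chart : Type ;
  chart_dom : chart -> set carrier ;
  chart_coord : chart -> carrier -> 'rV[R]_n ;
  chart_param : chart -> 'rV[R]_n -> carrier ;
  dom_open : forall a, open (chart_dom a) ;
  dom_cover : forall p, exists a, chart_dom a p ;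
  coord_image_open : forall a, open (chart_coord a @` chart_dom a) ;
  chart_coordK : forall a p, chart_dom a p ->
    chart_param a (chart_coord a p) = p ;
  coord_continuous : forall a p, chart_dom a p ->
    {for p, continuous (chart_coord a)} ;
  param_continuous : forall a x, (chart_coord a @` chart_dom a) x ->
    {for x, continuous (chart_param a)} ;
  transition_smooth : forall a b,
    smooth_on (chart_coord a @` (chart_dom a `&` chart_dom b))
      (chart_coord b \o chart_param a)
}.

Definition chart_image {R : realType} {n : nat} (M : smooth_manifold R n)
    (a : chart M) : set 'rV[R]_n :=
  chart_coord a @` chart_dom a.

(* Row i of the library's Jacobian matrix 'J f x is the i-th partial derivative
   of f, so row_free says that the differential is injective. *)
Definition immersion {R : realType} {n m : nat} (M : smooth_manifold R n)
    (F : M -> 'rV[R]_m) : Prop :=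
  forall a : chart M,
    smooth_on (chart_image a) (F \o chart_param a) /\
    (forall x, chart_image a x -> row_free (jacobian (F \o chart_param a) x)).

Definition dot {R : realType} {m : nat} (u v : 'rV[R]_m) : R :=
  \sum_(i < m) u 0 i * v 0 i.

(* Local geometry of a parametrization f : 'rV_n -> 'rV_m. Tangent vectors are
   given by their components in the coordinate basis d_0 f, ..., d_(n-1) f. *)

Definition induced_metric {R : realType} {n m : nat}
    (f : 'rV[R]_n -> 'rV[R]_m) (x : 'rV[R]_n) : 'M[R]_n :=
  \matrix_(i, j) dot (partial i f x) (partial j f x).

(* Gamma^l_ij of a metric g. *)
Definition christoffel {R : realType} {n : nat} (g : 'rV[R]_n -> 'M[R]_n)
    (l i j : 'I_n) (x : 'rV[R]_n) : R :=
  2^-1 * \sum_(m < n) invmx (g x) l m *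
    (partial i (fun y => g y j m : R^o) x + partial j (fun y => g y i m : R^o) x
     - partial m (fun y => g y i j : R^o) x).

(* R_ijkl = <R(d_i, d_j) d_l, d_k> with
   R(X, Y) = [nabla_X, nabla_Y] - nabla_[X, Y]. With this order of the indices
   R_ijij is the sectional curvature when d_i, d_j are orthonormal. *)
Definition riemann {R : realType} {n : nat} (g : 'rV[R]_n -> 'M[R]_n)
    (i j k l : 'I_n) (x : 'rV[R]_n) : R :=
  \sum_(m < n) g x k m *
    (partial i (christoffel g m j l : _ -> R^o) x
     - partial j (christoffel g m i l : _ -> R^o) x
     + \sum_(p < n) (christoffel g p j l x * christoffel g m i p x
                     - christoffel g p i l x * christoffel g m j p x)).

(* A skew matrix w stands for the bivector \sum_(i < j) w_ij d_i /\ d_j. *)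
Definition bivector {R : realType} {n : nat} (w : 'M[R]_n) : Prop :=
  w^T = - w.

Definition bivector_wedge {R : realType} {n : nat} (u v : 'rV[R]_n) : 'M[R]_n :=
  \matrix_(i, j) (u 0 i * v 0 j - u 0 j * v 0 i).

(* The bilinear form with (d_i /\ d_j, d_k /\ d_l) |-> R_ijkl. *)
Definition curvature_operator {R : realType} {n : nat}
    (g : 'rV[R]_n -> 'M[R]_n) (x : 'rV[R]_n) (w z : 'M[R]_n) : R :=
  \sum_(i < n) \sum_(j < n | (i < j)%N) \sum_(k < n) \sum_(l < n | (k < l)%N)
    w i j * z k l * riemann g i j k l x.

(* The bilinear form with
   (d_i /\ d_j, d_k /\ d_l) |-> g_ik g_jl - g_il g_jk;
   see bivector_dot_frame. *)
Definition bivector_dot {R : realType} {n : nat} (g w z : 'M[R]_n) : R :=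
  \sum_(i < n) \sum_(j < n | (i < j)%N) \sum_(k < n) \sum_(l < n | (k < l)%N)
    w i j * z k l * (g i k * g j l - g i l * g j k).

Definition normal_part {R : realType} {n m : nat} (f : 'rV[R]_n -> 'rV[R]_m)
    (x : 'rV[R]_n) (v : 'rV[R]_m) : 'rV[R]_m :=
  v - \sum_(i < n) \sum_(j < n)
        (invmx (induced_metric f x) i j * dot v (partial i f x))
          *: partial j f x.

(* h(d_i, d_j), as a vector of the ambient Euclidean space. *)
Definition second_ff {R : realType} {n m : nat} (f : 'rV[R]_n -> 'rV[R]_m)
    (i j : 'I_n) (x : 'rV[R]_n) : 'rV[R]_m :=
  normal_part f x (partial i (partial j f) x).

(* H = tr_g h; see mean_curvature_frame. *)
Definition mean_curvature {R : realType} {n m : nat}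
    (f : 'rV[R]_n -> 'rV[R]_m) (x : 'rV[R]_n) : 'rV[R]_m :=
  \sum_(i < n) \sum_(j < n) invmx (induced_metric f x) i j *: second_ff f i j x.

(* |h|^2 as the squared norm of the tensor h; see second_ff_sqnorm_frame. *)
Definition second_ff_sqnorm {R : realType} {n m : nat}
    (f : 'rV[R]_n -> 'rV[R]_m) (x : 'rV[R]_n) : R :=
  \sum_(i < n) \sum_(j < n) \sum_(k < n) \sum_(l < n)
    invmx (induced_metric f x) i k * invmx (induced_metric f x) j l
    * dot (second_ff f i j x) (second_ff f k l x).

(* Row i of e holds the coordinates of the i-th vector of a frame. *)
Definition tangent_frame {R : realType} {n : nat} (g e : 'M[R]_n) : Prop :=
  e *m g *m e^T = 1%:M.

Definition normal_frame {R : realType} {n k : nat}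
    (f : 'rV[R]_n -> 'rV[R]_(n + k)) (x : 'rV[R]_n) (nu : 'M[R]_(k, n + k)) :
    Prop :=
  (forall a b, dot (row a nu) (row b nu) = (a == b)%:R) /\
  (forall a i, dot (row a nu) (partial i f x) = 0).

(* h_ija = <h(e_i, e_j), nu_a>. *)
Definition second_ff_comp {R : realType} {n k : nat}
    (f : 'rV[R]_n -> 'rV[R]_(n + k)) (x : 'rV[R]_n) (e : 'M[R]_n)
    (nu : 'M[R]_(k, n + k)) (i j : 'I_n) (a : 'I_k) : R :=
  dot (\sum_(p < n) \sum_(q < n) (e i p * e j q) *: second_ff f p q x)
      (row a nu).

Section Frames.
Variables (R : realType) (n k : nat).
Implicit Types (e g : 'M[R]_n) (x : 'rV[R]_n).

Lemma dotE m (u v : 'rV[R]_m) : dot u v = (u *m v^T) 0 0.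
Proof. by rewrite mxE; apply: eq_bigr => i _; rewrite mxE. Qed.

Lemma dotDl m (u v w : 'rV[R]_m) : dot (u + v) w = dot u w + dot v w.
Proof. by rewrite !dotE mulmxDl mxE. Qed.

Lemma dotZl m (c : R) (u v : 'rV[R]_m) : dot (c *: u) v = c * dot u v.
Proof. by rewrite !dotE -scalemxAl mxE. Qed.

Lemma dotC m (u v : 'rV[R]_m) : dot u v = dot v u.
Proof. by apply: eq_bigr => i _; rewrite mulrC. Qed.

Lemma dot_suml m (I : Type) (r : seq I) (P : pred I) (u : I -> 'rV[R]_m) v :
  dot (\sum_(i <- r | P i) u i) v = \sum_(i <- r | P i) dot (u i) v.
Proof.
by rewrite dotE mulmx_suml summxE; apply: eq_bigr => i _; rewrite dotE.
Qed.

Lemma dot_sumr m (I : Type) (r : seq I) (P : pred I) (u : I -> 'rV[R]_m) v :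
  dot v (\sum_(i <- r | P i) u i) = \sum_(i <- r | P i) dot v (u i).
Proof. by rewrite dotC dot_suml; apply: eq_bigr => i _; rewrite dotC. Qed.

Lemma dotZr m (c : R) (u v : 'rV[R]_m) : dot u (c *: v) = c * dot u v.
Proof. by rewrite dotC dotZl dotC. Qed.

Lemma tangent_frame_inv g e : tangent_frame g e -> invmx g = e^T *m e.
Proof.
move=> ge; have /mulmx1C h : (e *m g) *m e^T = 1%:M by [].
rewrite mulmxA in h.
have [_ gu] := mulmx1_unit h.
by rewrite -[RHS]mulmx1 -(mulmxV gu) mulmxA h mul1mx.
Qed.

Lemma tangent_frame_invE g e i j : tangent_frame g e ->
  invmx g i j = \sum_(p < n) e p i * e p j.
Proof.
move=> /tangent_frame_inv ->; rewrite mxE.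
by apply: eq_bigr => p _; rewrite mxE.
Qed.

Lemma skew_wedge_sum (u v : 'rV[R]_n) (S : 'I_n -> 'I_n -> R) :
  (forall i j, S i j = - S j i) ->
  \sum_(i < n) \sum_(j < n | (i < j)%N) bivector_wedge u v i j * S i j =
  \sum_(i < n) \sum_(j < n) u 0 i * v 0 j * S i j.
Proof.
move=> skS; have S0 i : S i i = 0.
  by have := skS i i; lra.
pose a i j := u 0 i * v 0 j * S i j.
transitivity (\sum_(i < n) \sum_(j < n | (i < j)%N) (a i j + a j i)).
  apply: eq_bigr => i _; apply: eq_bigr => j _.
  by rewrite /a mxE [S j i]skS; ring.
under eq_bigr do rewrite big_split /=.
rewrite big_split /=.
have -> : \sum_(i < n) \sum_(j < n | (i < j)%N) a j i =
          \sum_(i < n) \sum_(j < n | (j < i)%N) a i j.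
  rewrite (exchange_big_dep xpredT) //=.
rewrite -big_split /=; apply: eq_bigr => i _.
rewrite [RHS](bigID (fun j : 'I_n => (i < j)%N)) /=; congr (_ + _).
rewrite [RHS](bigID (fun j : 'I_n => (j < i)%N)) /=.
rewrite [X in _ = _ + X]big1 ?addr0; last first.
  move=> j /andP[]; rewrite -!leqNgt => ji ij.
  have -> : j = i by apply/val_inj/anti_leq; rewrite /= ij ji.
  by rewrite S0 mulr0.
apply: eq_bigl => j; case: ltngtP => //.
Qed.

Lemma skew_wedge_sum2 (u v w z : 'rV[R]_n)
    (T : 'I_n -> 'I_n -> 'I_n -> 'I_n -> R) :
  (forall i j k l, T i j k l = - T j i k l) ->
  (forall i j k l, T i j k l = - T i j l k) ->
  \sum_(i < n) \sum_(j < n | (i < j)%N) \sum_(k < n) \sum_(l < n | (k < l)%N)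
    bivector_wedge u v i j * bivector_wedge w z k l * T i j k l =
  \sum_(i < n) \sum_(j < n) \sum_(k < n) \sum_(l < n)
    u 0 i * v 0 j * w 0 k * z 0 l * T i j k l.
Proof.
move=> T1 T2.
pose S i j := \sum_(k < n) \sum_(l < n) w 0 k * z 0 l * T i j k l.
transitivity
  (\sum_(i < n) \sum_(j < n | (i < j)%N) bivector_wedge u v i j * S i j).
  apply: eq_bigr => i _; apply: eq_bigr => j _.
  rewrite /S -skew_wedge_sum // mulr_sumr; apply: eq_bigr => p _.
  by rewrite mulr_sumr; apply: eq_bigr => q _; rewrite mulrA.
rewrite skew_wedge_sum => [|i j]; last first.
  rewrite /S -sumrN; apply: eq_bigr => p _; rewrite -sumrN.
  by apply: eq_bigr => q _; rewrite T1 mulrN.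
apply: eq_bigr => i _; apply: eq_bigr => j _; rewrite /S mulr_sumr.
apply: eq_bigr => p _; rewrite mulr_sumr.
by apply: eq_bigr => q _; rewrite !mulrA.
Qed.

(* The skew-symmetry in k, l holds for every metric of class C^2. *)
Lemma curvature_operator_wedge (g : 'rV[R]_n -> 'M[R]_n) x
    (u v w z : 'rV[R]_n) :
  (forall i j k l, riemann g i j k l x = - riemann g i j l k x) ->
  curvature_operator g x (bivector_wedge u v) (bivector_wedge w z) =
  \sum_(i < n) \sum_(j < n) \sum_(k < n) \sum_(l < n)
    u 0 i * v 0 j * w 0 k * z 0 l * riemann g i j k l x.
Proof.
move=> Rkl.
apply: (@skew_wedge_sum2 _ _ _ _ (fun i j k l => riemann g i j k l x)).
  move=> i j p q; rewrite /riemann -sumrN; apply: eq_bigr => m _.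
  rewrite -mulrN opprD opprB -sumrN; congr (_ * (_ + _)).
  by apply: eq_bigr => r _; rewrite opprB.
exact: Rkl.
Qed.

Lemma bivector_dot_wedge g (u v w z : 'rV[R]_n) :
  bivector_dot g (bivector_wedge u v) (bivector_wedge w z) =
  (u *m g *m w^T) 0 0 * (v *m g *m z^T) 0 0
  - (u *m g *m z^T) 0 0 * (v *m g *m w^T) 0 0.
Proof.
pose T i j p q := g i p * g j q - g i q * g j p.
rewrite /bivector_dot (@skew_wedge_sum2 _ _ _ _ T); first last.
- by move=> i j p q; rewrite /T opprB.
- by move=> i j p q; rewrite /T opprB mulrC [g j p * _]mulrC.
have bilE (a b : 'rV[R]_n) :
    (a *m g *m b^T) 0 0 = \sum_(i < n) \sum_(p < n) a 0 i * b 0 p * g i p.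
  rewrite -mulmxA mxE; apply: eq_bigr => i _; rewrite mxE mulr_sumr.
  by apply: eq_bigr => p _; rewrite mxE mulrA mulrAC.
have prodE (a b c d : 'rV[R]_n) :
    (a *m g *m b^T) 0 0 * (c *m g *m d^T) 0 0 =
    \sum_(i < n) \sum_(j < n) \sum_(p < n) \sum_(q < n)
      (a 0 i * b 0 p * g i p) * (c 0 j * d 0 q * g j q).
  rewrite !bilE mulr_suml; apply: eq_bigr => i _; rewrite mulr_sumr.
  apply: eq_bigr => j _; rewrite mulr_suml; apply: eq_bigr => p _.
  by rewrite mulr_sumr.
rewrite !prodE -sumrB; apply: eq_bigr => i _; rewrite -sumrB.
apply: eq_bigr => j _; rewrite [X in _ = _ - X]exchange_big -sumrB /=.
apply: eq_bigr => p _; rewrite -sumrB; apply: eq_bigr => q _.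
by rewrite /T; ring.
Qed.

Lemma bivector_dot_frame g e (i j p q : 'I_n) : tangent_frame g e ->
  (i < j)%N -> (p < q)%N ->
  bivector_dot g (bivector_wedge (row i e) (row j e))
    (bivector_wedge (row p e) (row q e)) =
  ((i == p) && (j == q))%:R.
Proof.
move=> ge ij pq; have eE a b : (row a e *m g *m (row b e)^T) 0 0 = (a == b)%:R.
  have := congr1 (fun A : matrix R n n => A a b) ge; rewrite [RHS]mxE => <-.
  by rewrite -row_mul !mxE; apply: eq_bigr => c _; rewrite !mxE.
rewrite bivector_dot_wedge !eE -natrM mulnb.
case: (i =P q) => [iq|_]; last by rewrite mul0r subr0.
case: (j =P p) => [jp|_]; last by rewrite mulr0 subr0.
by move: ij; rewrite iq jp ltnNge (ltnW pq).
Qed.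

Section FrameOfImmersion.
Variables (f : 'rV[R]_n -> 'rV[R]_(n + k)) (x : 'rV[R]_n).
Variables (e : 'M[R]_n) (nu : 'M[R]_(k, n + k)).
Hypotheses (fe : tangent_frame (induced_metric f x) e)
  (fnu : normal_frame f x nu).

Lemma second_ff_normal p q i : dot (second_ff f p q x) (partial i f x) = 0.
Proof.
rewrite /second_ff /normal_part -scaleN1r dotDl dotZl mulN1r dot_suml.
set v := partial p _ x; apply/eqP; rewrite subr_eq0; apply/eqP.
have gu : induced_metric f x \in unitmx.
  have /mulmx1C h := fe; rewrite mulmxA in h; exact: (mulmx1_unit h).2.
have h := mulVmx gu.
transitivity (\sum_(a < n) dot v (partial a f x) * (a == i)%:R).
  rewrite (bigD1 i) //= eqxx mulr1 big1 ?addr0 // => a /negPf ->.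
  by rewrite mulr0.
apply: eq_bigr => a _; rewrite dot_suml.
have := congr1 (fun A : matrix R n n => A a i) h; rewrite [RHS]mxE => <-.
rewrite mxE.
rewrite mulr_sumr; apply: eq_bigr => b _.
by rewrite dotZl [induced_metric _ _ b i]mxE mulrA [dot v _ * _]mulrC.
Qed.

Lemma normal_frame_expand (v : 'rV[R]_(n + k)) :
  (forall i, dot v (partial i f x) = 0) ->
  v = \sum_(a < k) dot v (row a nu) *: row a nu.
Proof.
move=> v0; case: fnu => nu1 nu0.
pose J : 'M[R]_(n, n + k) := \matrix_i partial i f x.
have rowJ i : row i J = partial i f x by rewrite rowK.
have mulTE m1 m2 (A : 'M[R]_(m1, n + k)) (B : 'M[R]_(m2, n + k)) i j :
    (A *m B^T) i j = dot (row i A) (row j B).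
  by rewrite mxE; apply: eq_bigr => c _; rewrite !mxE.
have JJ : J *m J^T = induced_metric f x.
  by apply/matrixP => i j; rewrite mulTE !rowJ mxE.
have vJ : v *m J^T = 0.
  by apply/matrixP => i j; rewrite mulTE rowJ row_id v0 mxE.
have nuJ : nu *m J^T = 0.
  by apply/matrixP => i j; rewrite mulTE rowJ nu0 mxE.
have nunu : nu *m nu^T = 1%:M.
  by apply/matrixP => i j; rewrite mulTE nu1 mxE.
have Jnu : J *m nu^T = 0 by rewrite -[LHS]trmxK trmx_mul trmxK nuJ trmx0.
pose B := col_mx (e *m J) nu.
have : B *m B^T = 1%:M.
  rewrite /B tr_col_mx mul_col_row trmx_mul !mulmxA -[e *m J *m J^T]mulmxA.
  rewrite JJ fe.
  rewrite -[e *m J *m nu^T]mulmxA Jnu mulmx0 nuJ mul0mx nunu.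
  by rewrite -scalar_mx_block.
move=> /mulmx1C; rewrite /B tr_col_mx mul_row_col trmx_mul.
move=> /(congr1 (mulmx v)); rewrite mulmx1 mulmxDr !mulmxA vJ !mul0mx add0r.
move=> {1}<-; rewrite [LHS]mulmx_sum_row; apply: eq_bigr => a _.
by congr (_ *: _); rewrite mulTE row_id.
Qed.

Lemma second_ff_frame_expand i j :
  \sum_(p < n) \sum_(q < n) (e i p * e j q) *: second_ff f p q x =
  \sum_(a < k) second_ff_comp f x e nu i j a *: row a nu.
Proof.
apply: normal_frame_expand => c; rewrite dot_suml big1 // => p _.
by rewrite dot_suml big1 // => q _; rewrite dotZl second_ff_normal mulr0.
Qed.

Lemma mean_curvature_frame :
  mean_curvature f x =
  \sum_(i < n) \sum_(a < k) second_ff_comp f x e nu i i a *: row a nu.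
Proof.
under [RHS]eq_bigr => i _ do rewrite -second_ff_frame_expand.
rewrite exchange_big /=; apply: eq_bigr => p _.
rewrite exchange_big /=; apply: eq_bigr => q _.
by rewrite -scaler_suml (tangent_frame_invE _ _ fe).
Qed.

Lemma second_ff_sqnorm_frame :
  second_ff_sqnorm f x =
  \sum_(i < n) \sum_(j < n) \sum_(a < k) second_ff_comp f x e nu i j a ^+ 2.
Proof.
pose hh p q r s := dot (second_ff f p q x) (second_ff f r s x).
transitivity (\sum_(i < n) \sum_(j < n)
    \sum_(p < n) \sum_(q < n) \sum_(r < n) \sum_(s < n)
      e i p * e j q * (e i r * e j s) * hh p q r s); last first.
  apply: eq_bigr => i _; apply: eq_bigr => j _.
  pose v := \sum_(p < n) \sum_(q < n) (e i p * e j q) *: second_ff f p q x.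
  transitivity (dot v v).
    rewrite /v dot_suml; apply: eq_bigr => p _.
    rewrite dot_suml; apply: eq_bigr => q _.
    rewrite dot_sumr; apply: eq_bigr => r _.
    rewrite dot_sumr; apply: eq_bigr => s _.
    by rewrite dotZl dotZr !mulrA.
  rewrite {2}/v second_ff_frame_expand dot_sumr; apply: eq_bigr => a _.
  by rewrite dotZr expr2.
symmetry.
under eq_bigr => i _ do rewrite exchange_big /=.
rewrite exchange_big /=; apply: eq_bigr => p _.
under eq_bigr => i _ do rewrite exchange_big /=.
rewrite exchange_big /=; apply: eq_bigr => q _.
under eq_bigr => i _ do rewrite exchange_big /=.
rewrite exchange_big /=; apply: eq_bigr => r _.
under eq_bigr => i _ do rewrite exchange_big /=.
rewrite exchange_big /=; apply: eq_bigr => s _.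
rewrite !(tangent_frame_invE _ _ fe).
rewrite -mulrA mulr_suml; apply: eq_bigr => i _.
rewrite mulr_suml mulr_sumr; apply: eq_bigr => j _.
by rewrite /hh; ring.
Qed.

End FrameOfImmersion.

End Frames.

(* Main.v *)
(* By the Gauss equation the curvature operator is the sum, over an orthonormal
   basis of the ambient space, of the forms induced on bivectors by the scalar
   components A of h. A g-orthonormal frame, depending on A, diagonalizes A;
   the e_i /\ e_j are then eigenvectors, with eigenvalues l_i l_j, and
   Cauchy-Schwarz for the n - 1 numbers l_i + l_j and l_q (q <> i, j) gives
   2 l_i l_j >= (tr A)^2 / (n - 1) - |A|^2. Summing over the components bounds
   the curvature operator below by half of |H|^2 / (n - 1) - |h|^2. *)
Require Import Defs.
From mathcomp Require Import all_boot all_order all_algebra.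
From mathcomp Require Import all_classical all_reals all_analysis.
From mathcomp Require Import perm complex spectral.
From mathcomp Require Import ring lra.

Set Implicit Arguments.
Unset Strict Implicit.
Unset Printing Implicit Defensive.

Import Order.TTheory GRing.Theory Num.Theory numFieldNormedType.Exports.
Local Open Scope classical_set_scope.
Local Open Scope ring_scope.

(** * Simultaneous diagonalization over a real closed field *)

Lemma mulmx_trE (F : comPzRingType) (m : nat) (u v : 'rV[F]_m) :
  u *m v^T = (\sum_(i < m) u 0 i * v 0 i)%:M.
Proof.
apply/matrixP => i j; rewrite !ord1 !mxE eqxx mulr1n.
by apply: eq_bigr => c _; rewrite mxE.
Qed.

Lemma sqnorm_gt0 (F : realDomainType) (m : nat) (u : 'rV[F]_m) :
  u != 0 -> 0 < \sum_(i < m) u 0 i * u 0 i.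
Proof.
move=> u0; rewrite lt_neqAle sumr_ge0 ?andbT; last first.
  by move=> i _; rewrite -expr2 sqr_ge0.
apply: contra u0 => /eqP/esym/eqP.
rewrite psumr_eq0 => [/allP h|i _]; last by rewrite -expr2 sqr_ge0.
apply/eqP/rowP => i; rewrite mxE; apply/eqP.
by have := h i (mem_index_enum _); rewrite -expr2 sqrf_eq0.
Qed.

(** Over the complex closure [F[i]] the matrix is Hermitian, so the spectral theorem gives an
    eigenvalue there, and it is real. *)
Lemma real_symmetric_eigenvalue (F : rcfType) (n : nat) (A : 'M[F]_n.+1) :
  A^T = A -> exists a, eigenvalue A a.
Proof.
move=> sA; pose A' := map_mx (real_complex F) A.
have realA' : A' \is a mxOver Num.real.
  by apply/mxOverP => i j; rewrite mxE complex_real.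
have symA' : A' \is symmetricmx.
  by apply/is_hermitianmxP; rewrite expr0 scale1r map_mx_id // /A' map_trmx sA.
have hA' := realsym_hermsym symA' realA'.
have /orthomx_spectralP := hermitian_normalmx hA'.
have /mxOverP/(_ 0 0) := hermitian_spectral_diag_real hA'.
set P := spectralmx A'; set d := spectral_diag A' => dreal A'E.
have Pu : P \in unitmx by apply: spectral_unit.
have : eigenvalue A' (d 0 0).
  apply/eigenvalueP; exists (row 0 P); last first.
    apply: contraTneq isT => /(congr1 (mulmxr (invmx P))) /=.
    rewrite mul0mx -row_mul mulmxV // => /rowP/(_ 0)/eqP.
    by rewrite !mxE oner_eq0.
  rewrite -row_mul A'E !mulmxA mulmxV // mul1mx row_mul row_diag_mx.
  by rewrite -scalemxAl -rowE.
(* A real [d 0 0] is the image of an element of [F]. Being an eigenvalue is being a root of the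
   characteristic polynomial, whose coefficients lie in [F], so it descends along the embedding. *)
have /RRe_real <- := dreal.
rewrite eigenvalue_root_char -map_char_poly fmorph_root -eigenvalue_root_char.
by exists (complex.Re (d 0 0)).
Qed.

(* The Householder reflection exchanging v and the first basis vector. *)
Lemma orthogonal_with_row (F : rcfType) (n : nat) (v : 'rV[F]_n.+1) :
  v *m v^T = 1%:M -> exists P : 'M[F]_n.+1, P *m P^T = 1%:M /\ row 0 P = v.
Proof.
move=> vv; pose e0 : 'rV[F]_n.+1 := delta_mx 0 0.
(* For [v = e0] the reflection vector vanishes and the identity serves instead. *)
have [->|ve] := eqVneq v e0.
  by exists 1%:M; rewrite trmx1 mulmx1 row1.
pose u := v - e0; have u0 : u != 0 by rewrite subr_eq0.
pose s := \sum_(i < n.+1) u 0 i * u 0 i.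
have s0 : 0 < s by apply: sqnorm_gt0.
have uu : u *m u^T = s%:M by rewrite mulmx_trE.
have eu : e0 *m u^T = (u 0 0)%:M.
  by apply/matrixP => i j; rewrite !ord1 -rowE !mxE eqxx mulr1n.
have vu : v *m u^T = (1 - v 0 0)%:M.
  rewrite /u linearB /= mulmxBr vv raddfB /=; congr (_ - _).
  apply/matrixP => i j; rewrite !ord1 trmx_delta -colE !mxE eqxx mulr1n.
  by [].
have u00 : u 0 0 = v 0 0 - 1 by rewrite !mxE !eqxx.
(* Both [v] and [e0] are unit vectors, so [s = - 2 * u 0 0]; this makes the reflection send [e0] to
   [e0 + u = v]. *)
have sE : s = 2 * (1 - v 0 0).
  have : u *m u^T = (1 - v 0 0 - u 0 0)%:M.
    by rewrite {1}/u mulmxBl vu eu -raddfB.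
  rewrite uu => /matrixP/(_ 0 0); rewrite ![_%:M 0 0]mxE eqxx !mulr1n => ->.
  by rewrite u00; ring.
have v1 : 1 - v 0 0 != 0 by move: s0; rewrite sE; lra.
pose P := 1%:M - (2 / s) *: (u^T *m u).
have OT : P^T = P by rewrite /P linearB /= trmx1 linearZ /= trmx_mul trmxK.
exists P; split.
  have PP : u^T *m u *m (u^T *m u) = s *: (u^T *m u).
    by rewrite mulmxA -(mulmxA _ u) uu mul_mx_scalar -scalemxAl.
  rewrite OT /P mulmxBl mul1mx (mulmxBr (_ *: _)) mulmx1 -scalemxAl -scalemxAr.
  rewrite PP !scalerA.
  have -> : 2 / s * (2 / s) * s = 2 / s + 2 / s by field; rewrite gt_eqF.
  by rewrite scalerDl opprB !addrA subrK addrK.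
rewrite rowE -/e0 /P mulmxBr mulmx1 -scalemxAr mulmxA eu mul_scalar_mx scalerA.
have -> : 2 / s * u 0 0 = -1 by rewrite sE u00; field.
by rewrite scaleN1r opprK /u addrC subrK.
Qed.

(** Induction on the size: a unit eigenvector completed to an orthogonal matrix splits off a 1 by 1
    block, and the remaining block is again symmetric. *)
Lemma real_symmetric_diag (F : rcfType) (n : nat) (A : 'M[F]_n) : A^T = A ->
  exists (P : 'M[F]_n) (d : 'rV[F]_n),
    P *m P^T = 1%:M /\ P *m A *m P^T = diag_mx d.
Proof.
elim: n A => [|n IHn] A sA.
  by exists 1%:M, 0; split; apply/matrixP => -[].
have [a /eigenvalueP[v vA v0]] := real_symmetric_eigenvalue sA.
pose c := Num.sqrt (\sum_(i < n.+1) v 0 i * v 0 i).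
have c0 : 0 < c by rewrite sqrtr_gt0 sqnorm_gt0.
have [|P [OO rO]] := @orthogonal_with_row F n (c^-1 *: v).
  rewrite linearZ /= -scalemxAl -scalemxAr mulmx_trE scalerA scale_scalar_mx.
  rewrite -[X in _ * X]sqr_sqrtr -/c; last first.
    by apply: sumr_ge0 => i _; rewrite -expr2 sqr_ge0.
  by congr (_%:M); field; rewrite gt_eqF.
pose B : 'M[F]_(1 + n) := P *m A *m P^T.
have sB : B^T = B by rewrite /B !trmx_mul trmxK sA mulmxA.
have rB : row 0 B = a *: delta_mx 0 0.
  rewrite /B row_mul row_mul rO -scalemxAl vA scalerA mulrC -scalerA -scalemxAl.
  by rewrite -rO -row_mul OO row1.
(* The first row is known from the eigenvector; symmetry of [B] transfers its zeros to the first
   column. *)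
have BE : B = block_mx a%:M 0 0 (drsubmx B).
  have ur : ursubmx B = 0.
    apply/matrixP => i j; rewrite !mxE.
    have /rowP/(_ (rshift 1 j)) := rB; rewrite !mxE => Bj.
    rewrite !ord1; have -> : lshift n 0 = 0 :> 'I_(1 + n) by apply: val_inj.
    by rewrite Bj eqxx /= mulr0.
  rewrite -{1}[B]submxK ur; congr block_mx.
    apply/matrixP => i j; rewrite !ord1 !mxE.
    have /rowP/(_ 0) := rB; rewrite !mxE !eqxx mulr1 mulr1n.
    by have -> : lshift n 0 = 0 :> 'I_(1 + n) by apply: val_inj.
  by rewrite -[LHS]trmxK trmx_dlsub sB ur trmx0.
have [|P' [d [OO' dE]]] := IHn (drsubmx B); first by rewrite trmx_drsub sB.
pose Q : 'M[F]_(1 + n) := block_mx 1%:M 0 0 P'.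
have QQ : Q *m Q^T = 1%:M.
  rewrite /Q tr_block_mx mulmx_block.
  rewrite !(mul0mx, mulmx0, trmx0, trmx1, mulmx1, addr0, add0r) OO'.
  by rewrite -scalar_mx_block.
have QB : Q *m B *m Q^T = diag_mx (row_mx a%:M d).
  rewrite BE /Q tr_block_mx !mulmx_block.
  rewrite !(mul0mx, mulmx0, trmx0, trmx1, mulmx1, mul1mx, addr0, add0r) dE.
  rewrite diag_mx_row; congr block_mx; apply/matrixP => i j.
  by rewrite !ord1 !mxE.
exists (Q *m P), (row_mx a%:M d); rewrite trmx_mul mulmxA.
rewrite -[Q *m P *m P^T]mulmxA OO mulmx1; split=> //.
by rewrite mulmxA -[Q *m P *m A]mulmxA -[Q *m _ *m P^T]mulmxA.
Qed.

(** Diagonalizing [g] and dividing row i by the square root of [d 0 i] gives a g-orthonormal frame.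
    In it [A] is still symmetric, and the orthogonal matrix diagonalizing it keeps the frame
    orthonormal. *)
Lemma simultaneous_diag (F : rcfType) (n : nat) (g A : 'M[F]_n) :
  g^T = g -> (forall x : 'rV[F]_n, x != 0 -> 0 < (x *m g *m x^T) 0 0) ->
  A^T = A ->
  exists (e : 'M[F]_n) (l : 'rV[F]_n),
    e *m g *m e^T = 1%:M /\ e *m A *m e^T = diag_mx l.
Proof.
move=> sg gpos sA; have [P [d [OO dE]]] := real_symmetric_diag sg.
have d0 i : 0 < d 0 i.
  have := gpos (row i P); rewrite -row_mul.
  have -> : (row i (P *m g) *m (row i P)^T) 0 0 = (P *m g *m P^T) i i.
    by rewrite !mxE; apply: eq_bigr => c _; rewrite !mxE.
  rewrite dE mxE eqxx mulr1n; apply.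
  apply: contraTneq isT => /(congr1 (mulmxr P^T)) /=.
  rewrite mul0mx -row_mul OO => /rowP/(_ i)/eqP.
  by rewrite !mxE eqxx oner_eq0.
pose D : 'M[F]_n := diag_mx (\row_i (Num.sqrt (d 0 i))^-1).
pose e := D *m P.
have eg : e *m g *m e^T = 1%:M.
  rewrite /e trmx_mul !mulmxA -[D *m P *m g]mulmxA -[D *m _ *m P^T]mulmxA dE.
  rewrite tr_diag_mx !mulmx_diag -diag_const_mx; congr diag_mx.
  apply/rowP => i; rewrite !mxE -{2}(@sqr_sqrtr _ (d 0 i)) ?(ltW (d0 _)) //.
  have : 0 < Num.sqrt (d 0 i) by rewrite sqrtr_gt0.
  by move=> ?; field; rewrite gt_eqF.
clearbody e.
have [|P' [l [OO' lE]]] := @real_symmetric_diag F n (e *m A *m e^T).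
  by rewrite [LHS]trmx_mul trmxK trmx_mul sA mulmxA.
exists (P' *m e), l; rewrite !trmx_mul !mulmxA; split.
  by rewrite -[P' *m e *m g]mulmxA -[P' *m _ *m e^T]mulmxA eg mulmx1.
by rewrite -[P' *m e *m A]mulmxA -[P' *m _ *m e^T]mulmxA lE.
Qed.

(** * The pinching inequality for one component *)

Lemma sum_lt_half (F : numFieldType) (n : nat) (T : 'I_n -> 'I_n -> F) :
  (forall i j, T i j = T j i) -> (forall i, T i i = 0) ->
  \sum_(i < n) \sum_(j < n | (i < j)%N) T i j =
  2^-1 * \sum_(i < n) \sum_(j < n) T i j.
Proof.
move=> Tsym T0.
set S := \sum_(i < n) \sum_(j < n | (i < j)%N) T i j.
suff -> : \sum_(i < n) \sum_(j < n) T i j = S + S by field.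
have SE : S = \sum_(i < n) \sum_(j < n | (j < i)%N) T i j.
  rewrite /S (exchange_big_dep xpredT) //=; apply: eq_bigr => i _.
  by apply: eq_bigr => j _.
rewrite {2}SE -big_split /=; apply: eq_bigr => i _.
rewrite (bigD1 i) //= T0 add0r (bigID (fun j : 'I_n => (i < j)%N)) /=.
congr (_ + _); apply: eq_bigl => j; rewrite -val_eqE /=.
  by case: ltngtP.
by case: ltngtP.
Qed.

(** For skew [w] the two products in each 2 by 2 minor contribute equally, which cancels the factor
    1/2 from [k < l]; the one from [i < j] remains. The trace form makes changes of frame easy. *)
Lemma bivector_dot_trace (R : realType) (n : nat) (A w : 'M[R]_n) :
  bivector w -> bivector_dot A w w = 2^-1 * \tr (A *m w *m A^T *m w^T).
Proof.
move=> /matrixP bw; have wN i j : w i j = - w j i.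
  by have := bw j i; rewrite !mxE.
have w0 i : w i i = 0 by have := wN i i; lra.
pose T i j := \sum_(k < n) \sum_(l < n) w i j * w k l * (A i k * A j l).
have kl i j : \sum_(k < n) \sum_(l < n | (k < l)%N)
    w i j * w k l * (A i k * A j l - A i l * A j k) = T i j.
  rewrite sum_lt_half => [|k l|k]; first last.
  - by rewrite w0 mulr0 mul0r.
  - by rewrite [w k l]wN; ring.
  under eq_bigr => k _ do
    (under eq_bigr => l _ do rewrite mulrBr; rewrite sumrB).
  rewrite sumrB -/(T i j).
  have -> : \sum_(k < n) \sum_(l < n) w i j * w k l * (A i l * A j k) = - T i j.
    rewrite exchange_big /T -sumrN; apply: eq_bigr => k _; rewrite -sumrN.
    by apply: eq_bigr => l _; rewrite [w l k]wN; ring.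
  by field.
rewrite /bivector_dot.
under eq_bigr => i _ do under eq_bigr => j _ do rewrite kl.
rewrite sum_lt_half => [|i j|i]; first last.
- by rewrite /T big1 // => k _; rewrite big1 // => l _; rewrite w0 !mul0r.
- rewrite /T exchange_big; apply: eq_bigr => k _; apply: eq_bigr => l _.
  by rewrite [w i j]wN [w l k]wN; ring.
congr (_ * _); rewrite /mxtrace; apply: eq_bigr => i _.
rewrite mxE; apply: eq_bigr => j _; rewrite mxE mulr_suml /T exchange_big.
apply: eq_bigr => l _; rewrite mxE !mulr_suml; apply: eq_bigr => k _.
by rewrite !mxE; ring.
Qed.

Lemma pinching_pair (F : realFieldType) (n : nat) (l : 'I_n -> F) (i j : 'I_n) :
  (2 <= n)%N -> i != j ->
  (\sum_q l q) ^+ 2 / (n%:R - 1) - \sum_q l q ^+ 2 <= 2 * (l i * l j).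
Proof.
(* a is the mean of the n - 1 numbers l_i + l_j and l_q, q <> i, j; the claim
   says that their variance is nonnegative. *)
move=> n2 ij; have ji : j != i by rewrite eq_sym.
set S := \sum_q l q; set Q := \sum_q l q ^+ 2.
have n1 : n%:R - 1 > 0 :> F by rewrite subr_gt0 ltr1n.
pose a := S / (n%:R - 1).
pose P q := (q != i) && (q != j).
have SE : S = l i + (l j + \sum_(q | P q) l q).
  by rewrite /S (bigD1 i) //= (bigD1 j).
have QE : Q = l i ^+ 2 + (l j ^+ 2 + \sum_(q | P q) l q ^+ 2).
  by rewrite /Q (bigD1 i) //= (bigD1 j).
have cP : n%:R = 2 + \sum_(q | P q) 1 :> F.
  have -> : n%:R = \sum_(q < n) 1 :> F by rewrite sumr_const card_ord.
  by rewrite (bigD1 i) //= (bigD1 j) //= addrA.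
have : 0 <= (l i + l j - a) ^+ 2 + \sum_(q | P q) (l q - a) ^+ 2.
  by rewrite addr_ge0 ?sqr_ge0 // sumr_ge0 // => q _; rewrite sqr_ge0.
have -> : \sum_(q | P q) (l q - a) ^+ 2 = \sum_(q | P q) l q ^+ 2
    - 2 * a * \sum_(q | P q) l q + a ^+ 2 * \sum_(q | P q) 1.
  rewrite !mulr_sumr -sumrB -big_split /=; apply: eq_bigr => q _; ring.
have -> : \sum_(q | P q) 1 = n%:R - 2 :> F by rewrite cP; ring.
have -> : \sum_(q | P q) l q ^+ 2 = Q - l i ^+ 2 - l j ^+ 2 by rewrite QE; ring.
have -> : \sum_(q | P q) l q = S - l i - l j by rewrite SE; ring.
move=> h; rewrite -subr_ge0; apply: le_trans h _.
(* After the substitutions the sum of squares equals the difference of the two sides exactly. *)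
rewrite le_eqVlt; apply/orP; left; apply/eqP; rewrite /a; field.
by rewrite gt_eqF.
Qed.

(** Cyclicity of the trace moves a change of frame from the bivector to the bilinear form. *)
Lemma trace_form_congr (R : realType) (n : nat) (e A w : 'M[R]_n) :
  \tr (A *m (e^T *m w *m e) *m A^T *m (e^T *m w *m e)^T) =
  \tr ((e *m A *m e^T) *m w *m (e *m A *m e^T)^T *m w^T).
Proof.
by rewrite !trmx_mul !trmxK !mulmxA [LHS]mxtrace_mulC !mulmxA.
Qed.

Section Pinching.
Variables (R : realType) (n : nat) (g : 'M[R]_n).
Hypotheses (gsym : g^T = g)
  (gpos : forall x : 'rV[R]_n, x != 0 -> 0 < (x *m g *m x^T) 0 0).

(** The witness [z] holds the components of [w] in the frame [e], where [g] is the identity and [A]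
    is diagonal. *)
Lemma bivector_dot_frame_diag (e A w : 'M[R]_n) (l : 'rV[R]_n) :
  tangent_frame g e -> e *m A *m e^T = diag_mx l -> bivector w ->
  exists2 z : 'M[R]_n, bivector z &
    bivector_dot A w w = 2^-1 * \sum_i \sum_j l 0 i * l 0 j * z i j ^+ 2 /\
    bivector_dot g w w = 2^-1 * \sum_i \sum_j z i j ^+ 2.
Proof.
move=> ge Ae bw; have eu : e \in unitmx.
  by move: (ge); rewrite /tangent_frame -mulmxA => /mulmx1_unit[].
pose u := invmx e; pose z := u^T *m w *m u.
have wE : w = e^T *m z *m e.
  by rewrite /z /u !mulmxA -trmx_mul mulVmx // trmx1 mul1mx mulmxKV.
have bz : bivector z.
  by rewrite /bivector /z !trmx_mul trmxK bw mulNmx mulmxN !mulmxA.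
clearbody z; exists z => //; rewrite !bivector_dot_trace //.
rewrite {1 2 3 4}wE !trace_form_congr Ae ge.
split; congr (_ * _); rewrite ?trmx1 ?mulmx1 ?mul1mx ?tr_diag_mx.
  apply: eq_bigr => i _; rewrite mxE; apply: eq_bigr => j _.
  by rewrite mul_diag_mx mul_mx_diag !mxE; ring.
by apply: eq_bigr => i _; rewrite mxE; apply: eq_bigr => j _; rewrite mxE expr2.
Qed.

Lemma bivector_dot_ge0 (w : 'M[R]_n) : bivector w -> 0 <= bivector_dot g w w.
Proof.
(* Any g-orthonormal frame will do, so [g] itself is taken as the form to diagonalize. *)
move=> bw; have [e [l [ge le]]] := simultaneous_diag gsym gpos gsym.
have [z _ [_ ->]] := bivector_dot_frame_diag ge le bw.
rewrite mulr_ge0 ?invr_ge0 ?ler0n //.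
by apply: sumr_ge0 => i _; apply: sumr_ge0 => j _; apply: sqr_ge0.
Qed.

(** The two traces are the g-trace and the squared g-norm of [A]. In a diagonalizing frame both
    sides are sums weighted by the squares of [z i j], and [pinching_pair] compares them term by
    term. *)
Lemma bivector_dot_pinching (A w : 'M[R]_n) : (2 <= n)%N -> A^T = A ->
  bivector w ->
  ((\tr (invmx g *m A)) ^+ 2 / (n%:R - 1)
     - \tr (invmx g *m A *m (invmx g *m A))) * bivector_dot g w w
  <= 2 * bivector_dot A w w.
Proof.
move=> n2 sA bw; have [e [l [ge le]]] := simultaneous_diag gsym gpos sA.
have [z bz [-> ->]] := bivector_dot_frame_diag ge le bw.
rewrite (tangent_frame_inv ge).
have -> : \tr (e^T *m e *m A) = \sum_i l 0 i.
  by rewrite -mulmxA mxtrace_mulC le mxtrace_diag.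
have -> : \tr (e^T *m e *m A *m (e^T *m e *m A)) = \sum_i l 0 i ^+ 2.
  rewrite -!mulmxA mxtrace_mulC !mulmxA le -mulmxA -!mulmxA.
  rewrite (mulmxA e A) le mulmx_diag mxtrace_diag.
  by apply: eq_bigr => i _; rewrite mxE expr2.
rewrite mulrCA [leRHS]mulrCA ler_pM2l ?invr_gt0 ?ltr0n // !mulr_sumr.
apply: ler_sum => i _; rewrite !mulr_sumr; apply: ler_sum => j _.
(* [pinching_pair] says nothing for [i = j], but there the skew [z] vanishes. *)
have [->|ij] := eqVneq i j.
  have -> : z j j = 0 by have /matrixP/(_ j j) := bz; rewrite !mxE; lra.
  by rewrite expr0n !mulr0.
rewrite [leRHS]mulrA; apply: ler_wpM2r; first exact: sqr_ge0.
exact: (pinching_pair (fun q => l 0 q)).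
Qed.

End Pinching.

(** * Symmetry of second derivatives *)

(** The two difference quotients coincide as functions of the increment; this gives access to the
    mean value theorem in one variable. *)
Lemma is_derive_line (R : realType) (V : normedModType R) (f : V -> R)
    (y u : V) (s df : R) : is_derive (s *: u + y) u f df ->
  is_derive s 1 (fun r : R => f (r *: u + y)) df.
Proof.
move=> [dfu <-].
pose q h := h^-1 *: (f (h *: u + (s *: u + y)) - f (s *: u + y)).
have qE : (fun h => h^-1 *: (((fun r : R => f (r *: u + y)) \o shift s) (h *: 1)
    - f (s *: u + y))) = q.
  by apply/funext => h; rewrite /q /= [h *: 1]mulr1 scalerDl addrA.
by apply: DeriveDef; rewrite /derivable /derive qE.
Qed.

Lemma differentiable_bound (R : realType) (V : normedModType R) (f : V -> R)
    (x : V) (e : R) : differentiable f x -> 0 < e ->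
  \forall w \near (0 : V), `|f (w + x) - f x - 'd f x w| <= e * `|w|.
Proof.
move=> df e0; have := diff_locally df => /eqaddoP/(_ _ e0).
by apply: filterS => w; rewrite !fctE /= opprD addrA.
Qed.

Section Clairaut.
Context {R : realType} {V : normedModType R} (f : V -> R).

Definition second_difference (x u v : V) (t : R) : R :=
  f (t *: u + (t *: v + x)) - f (t *: u + x) - f (t *: v + x) + f x.

(** The mean value theorem along [u] turns the second difference into [t] times a difference of two
    values of [g]; the first-order expansion of [g] at [x] then applies to both. *)
Lemma second_difference_approx (g : V -> R) (x u v : V) (e : R) :
  (\forall y \near x, is_derive y u f (g y)) -> differentiable g x -> 0 < e ->
  \forall t \near 0^'+,
    `|second_difference x u v t - t ^+ 2 * 'D_v g x| <= e * t ^+ 2.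
Proof.
move=> dfu dDu e0.
(* Two remainders of size at most [e / c * (t * (|u| + |v|))] then add up to at most [e * t]; the
   summand 1 keeps [c] positive. *)
pose c := 2 * (`|u| + `|v|) + 1.
have c0 : 0 < c by rewrite /c; have := normr_ge0 u; have := normr_ge0 v; lra.
have /nbhs_ballP[d1 /= d10 hd1] : nbhs x [set y | is_derive y u f (g y)] by [].
have := differentiable_bound dDu (divr_gt0 e0 c0).
move=> /nbhs_ballP[d2 /= d20 hd2].
pose d := Num.min d1 d2; have d0 : 0 < d by rewrite lt_min d10.
near=> t.
have t0 : 0 < t by near: t; exact: nbhs_right_gt.
have td : t < d / c by near: t; apply: nbhs_right_lt; rewrite divr_gt0.
have small a b : 0 <= a <= t -> 0 <= b <= t ->
    `|a *: u + b *: v| <= t * (`|u| + `|v|) /\ `|a *: u + b *: v| < d.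
  move=> /andP[a0 at_] /andP[b0 bt].
  have ab : `|a *: u + b *: v| <= t * (`|u| + `|v|).
    rewrite (le_trans (ler_normD _ _)) // !normrZ !ger0_norm // mulrDr lerD //.
      by rewrite ler_wpM2r.
    by rewrite ler_wpM2r.
  split=> //; apply: le_lt_trans ab _.
  apply: (@le_lt_trans _ _ (t * c)); last by rewrite -ltr_pdivlMr.
  rewrite ler_wpM2l ?(ltW t0) // /c.
  by have := normr_ge0 u; have := normr_ge0 v; lra.
have dom a b : 0 <= a <= t -> 0 <= b <= t ->
    is_derive (a *: u + (b *: v + x)) u f (g (a *: u + (b *: v + x))).
  move=> ha hb; apply: hd1; rewrite -ball_normE /= addrA opprD addrCA.
  rewrite subrr addr0 normrN; have [_ ] := small _ _ ha hb.
  by move=> /lt_le_trans; apply; rewrite ge_min lexx.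
have bnd a b : 0 <= a <= t -> 0 <= b <= t ->
    `|g (a *: u + (b *: v + x)) - g x - 'd g x (a *: u + b *: v)|
    <= e / c * (t * (`|u| + `|v|)).
  move=> ha hb; have [h1 h2] := small _ _ ha hb.
  rewrite addrA; apply: le_trans (hd2 _ _) _.
    rewrite -ball_normE /= sub0r normrN (lt_le_trans h2) //.
    by rewrite ge_min lexx orbT.
  by rewrite ler_wpM2l // ltW // divr_gt0.
pose phi (s : R) := f (s *: u + (t *: v + x)) - f (s *: u + x).
pose dphi (s : R) := g (s *: u + (t *: v + x)) - g (s *: u + x).
have tt : 0 <= t <= t by rewrite (ltW t0) /=.
have z0 : 0 <= (0 : R) <= t by rewrite (ltW t0) andbT.
have dphiP s : 0 <= s <= t -> is_derive s 1 phi (dphi s).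
  move=> hs; apply: is_deriveB; apply: is_derive_line; first exact: dom.
  by have := dom _ _ hs z0; rewrite scale0r add0r.
have [||s /=] := @MVT R phi dphi 0 t t0.
- by move=> s; rewrite in_itv /= => /andP[s0 st]; apply: dphiP; rewrite !ltW.
- apply: derivable_within_continuous => s; rewrite in_itv /= => hs.
  by have [] := dphiP _ hs.
rewrite in_itv /= => /andP[/ltW s0 /ltW st] phiE.
have hs : 0 <= s <= t by rewrite s0.
have -> : second_difference x u v t = dphi s * t.
  rewrite -[t in RHS]subr0 -phiE /second_difference /phi !scale0r !add0r.
  by ring.
have -> : 'D_v g x = 'd g x v by rewrite deriveE.
have b1 := bnd s t hs tt; have b2 := bnd s 0 hs z0.
rewrite scale0r add0r addr0 in b2.
have dZ (a : R) w : 'd g x (a *: w) = a *: 'd g x w by rewrite linearZ.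
rewrite linearD /= !dZ in b1; rewrite dZ in b2.
(* The linear terms in [s] cancel, which leaves two first-order remainders of [g] at [x], both
   controlled by [bnd]. *)
have -> : dphi s * t - t ^+ 2 * 'd g x v =
    t * ((g (s *: u + (t *: v + x)) - g x - (s *: 'd g x u + t *: 'd g x v))
     - (g (s *: u + x) - g x - s *: 'd g x u)).
  by rewrite /dphi /GRing.scale /=; ring.
rewrite normrM (gtr0_norm t0) expr2 mulrCA ler_pM2l //.
apply: le_trans (ler_normB _ _) _.
apply: (@le_trans _ _
  (e / c * (t * (`|u| + `|v|)) + e / c * (t * (`|u| + `|v|)))).
  exact: lerD.
have -> : e / c * (t * (`|u| + `|v|)) + e / c * (t * (`|u| + `|v|)) =
    e * t * (2 * (`|u| + `|v|) / c) by ring.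
rewrite mulrC ler_piMl ?mulr_ge0 ?(ltW e0) ?(ltW t0) //.
by rewrite ler_pdivrMr // mul1r /c lerDl.
Unshelve. all: by end_near. Qed.


End Clairaut.

Lemma dist_le_of_scaled_approx (F : realFieldType) (S A B e T : F) : 0 < T ->
  `|S - T * A| <= e / 2 * T -> `|S - T * B| <= e / 2 * T -> `|A - B| <= e.
Proof.
move=> T0 hA hB; rewrite -(ler_pM2l T0) -{1}(gtr0_norm T0) -normrM.
have -> : T * (A - B) = (S - T * B) - (S - T * A) by ring.
apply: le_trans (ler_normB _ _) _; rewrite [leRHS]mulrC [e]splitr mulrDl.
exact: lerD.
Qed.

(** The second difference is symmetric in [u] and [v], and divided by [t ^+ 2] it approximates both
    mixed derivatives. *)
Lemma clairaut (R : realType) (V : normedModType R) (f g h : V -> R)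
    (x u v : V) :
  (\forall y \near x, is_derive y u f (g y)) ->
  (\forall y \near x, is_derive y v f (h y)) ->
  differentiable g x -> differentiable h x -> 'D_v g x = 'D_u h x.
Proof.
move=> dfu dfv du dv.
apply/eqP; rewrite -subr_eq0 -normr_le0; apply/ler_addgt0Pl => e e0.
rewrite addr0; have e2 : 0 < e / 2 by rewrite divr_gt0.
have H1 := second_difference_approx v dfu du e2.
have H2 := second_difference_approx u dfv dv e2.
have H : \forall t \near (0 : R)^'+,
    [/\ `|second_difference f x u v t - t ^+ 2 * 'D_v g x|
          <= e / 2 * t ^+ 2,
        `|second_difference f x v u t - t ^+ 2 * 'D_u h x|
          <= e / 2 * t ^+ 2
      & 0 < t].
  by apply: filterS3 H1 H2 (nbhs_right_gt 0) => t a b c; exact (And3 a b c).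
have [t [h1 h2 t0]] := @filter_ex _ _ (at_right_proper_filter 0) _ H.
have sC : second_difference f x v u t = second_difference f x u v t.
  by rewrite /second_difference addrCA; congr (_ + _); rewrite addrAC.
rewrite sC in h2; have t2 : 0 < t ^+ 2 by exact: exprn_gt0.
exact: (dist_le_of_scaled_approx t2 h1 h2).
Qed.

(** * Derivability of Gram matrices and their inverses *)

Section Derivability.
Context {R : realType} {V : normedModType R}.
Implicit Types (x v : V).

Lemma is_derive_entry m p (M : V -> 'M[R]_(m, p)) x v i j :
  derivable M x v -> is_derive x v (fun y => M y i j) ('D_v M x i j).
Proof.
move=> dM; apply: DeriveDef; first exact: (derivable_mxP M x v).1.
by rewrite derive_mx // mxE.
Qed.

Lemma is_derive_bigsum (I : Type) (r : seq I) (h : I -> V -> R)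
    (dh : I -> R) x v :
  (forall i, is_derive x v (h i) (dh i)) ->
  is_derive x v (fun y => \sum_(i <- r) h i y) (\sum_(i <- r) dh i).
Proof.
move=> dhP; elim: r => [|i r IHr].
  have -> : (fun y => \sum_(i <- [::]) h i y) = cst 0.
    by apply/funext => y; rewrite big_nil.
  rewrite big_nil; exact: is_derive_cst.
have -> : (fun y => \sum_(j <- i :: r) h j y) =
    h i + (fun y => \sum_(j <- r) h j y).
  by apply/funext => y; rewrite big_cons.
by rewrite big_cons; apply: is_deriveD.
Qed.

Lemma derivable_prod (I : Type) (r : seq I) (h : I -> V -> R) x v :
  (forall i, derivable (h i) x v) ->
  derivable (fun y => \prod_(i <- r) h i y) x v.
Proof.
move=> dh; elim: r => [|i r IHr].
  have -> : (fun y => \prod_(i <- [::]) h i y) = cst 1.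
    by apply/funext => y; rewrite big_nil.
  exact: derivable_cst.
have -> : (fun y => \prod_(j <- i :: r) h j y) =
    h i * (fun y => \prod_(j <- r) h j y).
  by apply/funext => y; rewrite big_cons.
exact: derivableM.
Qed.

Lemma is_derive_mul (f g : V -> R) x v (df dg : R) :
  is_derive x v f df -> is_derive x v g dg ->
  is_derive x v (fun y => f y * g y) (df * g x + f x * dg).
Proof.
move=> hf hg; have := is_deriveM hf hg.
by rewrite /GRing.scale /= [g x * _]mulrC addrC.
Qed.

Lemma is_derive_dot m (u w : V -> 'rV[R]_m) x v :
  derivable u x v -> derivable w x v ->
  is_derive x v (fun y => dot (u y) (w y))
    (dot ('D_v u x) (w x) + dot (u x) ('D_v w x)).
Proof.
move=> du dw; rewrite /dot -big_split /=.
by apply: is_derive_bigsum => i; apply: is_derive_mul; apply: is_derive_entry.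
Qed.

Lemma derivable_det n (M : V -> 'M[R]_n) x v :
  (forall i j, derivable (fun y => M y i j) x v) ->
  derivable (fun y => \det (M y)) x v.
Proof.
move=> dM; rewrite /determinant.
suff dh (s : {perm 'I_n}) :
    derivable (fun y => (-1) ^+ s * \prod_i M y i (s i)) x v.
  by have [] := is_derive_bigsum (index_enum _) (fun s => derivableP (dh s)).
apply: (@derivableM _ _ (cst ((-1) ^+ s))); first exact: derivable_cst.
exact: derivable_prod.
Qed.

Lemma derivable_invmx n (M : V -> 'M[R]_n) x v l m :
  (\forall y \near x, M y \in unitmx) ->
  (forall i j, derivable (fun y => M y i j) x v) ->
  derivable (fun y => invmx (M y) l m) x v.
Proof.
move=> uM dM.
(* Cramer's rule. It agrees with [invmx] only where [M y] is invertible, since [invmx] returns its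
   argument elsewhere; hence the equality is claimed near [x]. *)
pose q y := (\det (M y))^-1 * ((-1) ^+ (m + l) * \det (row' m (col' l (M y)))).
have qE : \near x, q x = invmx (M x) l m.
  by apply: filterS uM => y My; rewrite /q /invmx My !mxE.
apply: (near_eq_derivable qE).
apply: (@derivableM _ _ (fun y => (\det (M y))^-1)).
  apply: derivableV; last exact: derivable_det.
  by have := nbhs_singleton uM; rewrite unitmxE unitfE.
apply: (@derivableM _ _ (cst ((-1) ^+ (m + l)))); first exact: derivable_cst.
apply: derivable_det => i j.
have -> : (fun y => (row' m (col' l (M y))) i j) =
    (fun y => M y (lift m i) (lift l j)).
  by apply/funext => y; rewrite !mxE.
exact: dM.
Qed.

End Derivability.

(** * The Gauss equation for a parametrization *)

Section Gauss.
Context {R : realType} {n m : nat} (U : set 'rV[R]_n)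
  (f : 'rV[R]_n -> 'rV[R]_m).
Hypothesis openU : open U.

Lemma partial_comm (i j : 'I_n) (x : 'rV[R]_n) : U x ->
  (forall y, U y -> differentiable f y) ->
  (forall k, differentiable (partial k f) x) ->
  partial i (partial j f) x = partial j (partial i f) x.
Proof.
move=> Ux df ddf; have nU : \forall y \near x, U y by exact: open_nbhs_nbhs.
pose d i : 'rV[R]_n := delta_mx 0 i.
have D := fun k v => @diff_derivable _ _ _ (partial k f) x v (ddf k).
apply/rowP => c.
have E k l : partial l (partial k f) x 0 c =
    'D_(d l) (fun y => partial k f y 0 c : R) x.
  exact (esym (@derive_val _ _ _ _ _ _ _ (is_derive_entry 0 c (D k (d l))))).
refine (etrans (E j i) (etrans _ (esym (E i j)))).
have de k : differentiable (fun y => partial k f y 0 c : R) x.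
  apply: (@differentiable_comp _ _ _ _ (partial k f)
    (fun M => M 0 c : R)) => //.
  exact: differentiable_coord.
have nf k : \forall y \near x,
    is_derive y (d k) (fun z => f z 0 c : R) (partial k f y 0 c).
  apply: filterS nU => y Uy; apply: is_derive_entry.
  exact/diff_derivable/df.
exact: (clairaut (nf j) (nf i) (de j) (de i)).
Qed.

End Gauss.

Definition gram (R : realType) (n m : nat) (B : 'I_n -> 'rV[R]_m) : 'M[R]_n :=
  \matrix_(i, j) dot (B i) (B j).

(* The coordinates in the family B of the projection of a to its span. *)
Definition coords (R : realType) (n m : nat) (B : 'I_n -> 'rV[R]_m)
    (a : 'rV[R]_m) (l : 'I_n) : R :=
  \sum_q invmx (gram B) l q * dot a (B q).

(** The normal equations of the orthogonal projection to the span of [B]. *)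
Lemma gram_coords (R : realType) (n m : nat) (B : 'I_n -> 'rV[R]_m)
    (a : 'rV[R]_m) (k : 'I_n) : gram B \in unitmx ->
  \sum_l gram B k l * coords B a l = dot a (B k).
Proof.
move=> Bu; transitivity (\sum_q (gram B *m invmx (gram B)) k q * dot a (B q)).
  under eq_bigr do rewrite mulr_sumr.
  rewrite exchange_big; apply: eq_bigr => q _; rewrite mxE mulr_suml.
  by apply: eq_bigr => l _; rewrite mulrA.
rewrite mulmxV // (bigD1 k) //= mxE eqxx mul1r big1 ?addr0 // => q qk.
by rewrite mxE eq_sym (negPf qk) mul0r.
Qed.

(** Differentiating the normal equations determines the derivatives of the coordinates implicitly;
    the inverse Gram matrix only has to be derivable, and no formula for its derivative enters. *)
Lemma derive_gram_coords (R : realType) (V : normedModType R) (n m : nat)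
    (B : 'I_n -> V -> 'rV[R]_m) (a : V -> 'rV[R]_m) (x v : V) (k : 'I_n) :
  (\forall y \near x, gram (B^~ y) \in unitmx) ->
  (forall i, derivable (B i) x v) -> derivable a x v ->
  \sum_l ((dot ('D_v (B k) x) (B l x) + dot (B k x) ('D_v (B l) x))
            * coords (B^~ x) (a x) l
          + gram (B^~ x) k l * 'D_v (fun y => coords (B^~ y) (a y) l) x) =
  dot ('D_v a x) (B k x) + dot (a x) ('D_v (B k) x).
Proof.
move=> Gu dB da.
have dG i j : is_derive x v (fun y => gram (B^~ y) i j)
    (dot ('D_v (B i) x) (B j x) + dot (B i x) ('D_v (B j) x)).
  have -> : (fun y => gram (B^~ y) i j) = (fun y => dot (B i y) (B j y)).
    by apply/funext => y; rewrite mxE.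
  exact (is_derive_dot (dB i) (dB j)).
have dC l : derivable (fun y => coords (B^~ y) (a y) l) x v.
  have dI q : derivable (fun y => invmx (gram (B^~ y)) l q) x v.
    exact (@derivable_invmx _ _ _ _ _ _ l q Gu
      (fun i j => @ex_derive _ _ _ _ _ _ _ (dG i j))).
  have dA q := is_derive_dot da (dB q).
  by have [] := is_derive_bigsum (index_enum _)
    (fun q => is_derive_mul (derivableP (dI q)) (dA q)).
have dS := is_derive_bigsum (index_enum _)
  (fun l => is_derive_mul (dG k l) (derivableP (dC l))).
have E : \near x, \sum_l gram (B^~ x) k l * coords (B^~ x) (a x) l
    = dot (a x) (B k x).
  by apply: filterS Gu => y; exact: gram_coords.
have [_ <-] := dS; rewrite (near_eq_derive v E).
by have [] := is_derive_dot da (dB k).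
Qed.

Section GaussAlgebra.
Context {R : realType} {n m : nat}.
(** Values at one point: [B], [A], [T] stand for the first, second and third partial derivatives of
    the parametrization, [c l i j] for the Christoffel symbol with upper index l, [dc i q j l] for
    the i-th derivative of [c q j l], and [h] for the second fundamental form. *)
Variables (B : 'I_n -> 'rV[R]_m) (A : 'I_n -> 'I_n -> 'rV[R]_m)
  (T : 'I_n -> 'I_n -> 'I_n -> 'rV[R]_m)
  (dc : 'I_n -> 'I_n -> 'I_n -> 'I_n -> R).
Hypotheses (Bu : gram B \in unitmx) (TC : forall i j l, T i j l = T j i l).

Let c l i j := coords B (A i j) l.
Let h i j := A i j - \sum_q c q i j *: B q.

Lemma dot_normal i j k : dot (h i j) (B k) = 0.
Proof.
rewrite /h -scaleN1r dotDl dotZl dot_suml mulN1r.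
have <- := gram_coords (A i j) k Bu.
apply/eqP; rewrite subr_eq0; apply/eqP; apply: eq_bigr => q _.
by rewrite dotZl mxE dotC mulrC.
Qed.

(** As [h i j] is normal, the tangential part of [A p q] contributes nothing. *)
Lemma dot_normal_normal i j p q : dot (h i j) (h p q) =
  dot (A i j) (A p q) - \sum_l c l i j * dot (A p q) (B l).
Proof.
rewrite dotC {1}/h -scaleN1r dotDl dotZl dot_suml.
rewrite [X in _ + -1 * X]big1 => [|l _]; last first.
  by rewrite dotZl dotC dot_normal mulr0.
rewrite mulr0 addr0 dotC /h -scaleN1r dotDl dotZl dot_suml mulN1r.
by congr (_ - _); apply: eq_bigr => l _; rewrite dotZl dotC.
Qed.

Hypothesis dcE : forall i j l k,
  \sum_q ((dot (A i k) (B q) + dot (B k) (A i q)) * c q j l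
          + gram B k q * dc i q j l) =
  dot (T i j l) (B k) + dot (A j l) (A i k).

(* Both sides come from differentiating <a, B k> = sum_q g_kq c^q, with
   a = A j l: the terms in which g is differentiated cancel the products of the
   c's, and the third derivatives T drop out by symmetry. *)
Lemma gauss_algebra i j k l :
  \sum_q gram B k q * (dc i q j l - dc j q i l
     + \sum_p (c p j l * c q i p - c p i l * c q j p)) =
  dot (h i k) (h j l) - dot (h j k) (h i l).
Proof.
(* The left side is the inner product of the iterated covariant derivative nabla_i' nabla_j' d_l
   with d_k; the curvature is its antisymmetrization in i', j'. *)
have X i' j' : \sum_q gram B k q * (dc i' q j' l + \sum_p c p j' l * c q i' p) =
    dot (T i' j' l) (B k) + dot (h j' l) (h i' k).
  have -> : \sum_q gram B k q * (dc i' q j' l + \sum_p c p j' l * c q i' p) =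
      \sum_q gram B k q * dc i' q j' l
      + \sum_p c p j' l * dot (A i' p) (B k).
    under eq_bigr do rewrite mulrDr mulr_sumr.
    rewrite big_split /= exchange_big /=; congr (_ + _); apply: eq_bigr => p _.
    rewrite -(gram_coords _ k Bu) mulr_sumr; apply: eq_bigr => q _.
    by rewrite mulrCA.
  have := dcE i' j' l k; rewrite big_split /= => /(canRL (addKr _)) ->.
  rewrite dot_normal_normal.
  have -> : \sum_q (dot (A i' k) (B q) + dot (B k) (A i' q)) * c q j' l =
      \sum_q c q j' l * dot (A i' k) (B q)
      + \sum_q c q j' l * dot (A i' q) (B k).
    rewrite -big_split /=; apply: eq_bigr => q _.
    by rewrite [dot (B k) _]dotC; ring.
  by ring.
transitivity (\sum_q gram B k q * (dc i q j l + \sum_p c p j l * c q i p)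
    - \sum_q gram B k q * (dc j q i l + \sum_p c p i l * c q j p)).
  rewrite -sumrB; apply: eq_bigr => q _; rewrite sumrB; ring.
rewrite (X i j) (X j i) (TC i j l) (dotC (h i k)) (dotC (h j k)).
by rewrite opprD addrACA subrr add0r.
Qed.

End GaussAlgebra.

(** Koszul's cancellation: [a], [b], [c] are derivatives of the metric, [t] is an entry of its
    inverse, and symmetry of the Hessian leaves [dot Aij Bq] twice. *)
Lemma first_kind_christoffel (R : realType) (m : nat)
    (Bi Bj Bq Aij Aji Aiq Aqi Ajq Aqj : 'rV[R]_m) (t a b c : R) :
  Aji = Aij -> Aqi = Aiq -> Aqj = Ajq ->
  a = dot Aij Bq + dot Bj Aiq -> b = dot Aji Bq + dot Bi Ajq ->
  c = dot Aqi Bj + dot Bi Aqj ->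
  2^-1 * (t * (a + b - c)) = t * dot Aij Bq.
Proof. by move=> -> -> -> -> -> ->; rewrite (dotC Aiq); field. Qed.

Section GaussEquation.
Context {R : realType} {n m : nat} (U : set 'rV[R]_n)
  (f : 'rV[R]_n -> 'rV[R]_m).
Hypotheses (openU : open U) (diff1 : forall y, U y -> differentiable f y)
  (diff2 : forall i y, U y -> differentiable (partial i f) y)
  (diff3 : forall i j y, U y -> differentiable (partial i (partial j f)) y)
  (metric_unit : forall y, U y -> induced_metric f y \in unitmx).

Let B y k := partial k f y.
Let A y i j := partial i (partial j f) y.
Let nearU x : U x -> \forall y \near x, U y.
Proof. by move=> Ux; exact: open_nbhs_nbhs. Qed.

Lemma hessian_comm i j y : U y -> A y i j = A y j i.
Proof.
move=> Uy.
exact (@partial_comm _ _ _ _ _ openU i j _ Uy diff1 (fun k => diff2 k Uy)).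
Qed.

Lemma partial_metric i j k y : U y ->
  partial i (fun z => induced_metric f z j k : R^o) y =
  dot (A y i j) (B y k) + dot (B y j) (A y i k).
Proof.
move=> Uy; have -> : (fun z => induced_metric f z j k : R^o) =
    (fun z => dot (partial j f z) (partial k f z) : R^o).
  by apply/funext => z; rewrite mxE.
exact (@derive_val _ _ _ _ _ _ _ (is_derive_dot
  (@diff_derivable _ _ _ _ _ (delta_mx 0 i) (diff2 j Uy))
  (@diff_derivable _ _ _ _ _ (delta_mx 0 i) (diff2 k Uy)))).
Qed.

(** This links the intrinsic and the extrinsic side: the Levi-Civita connection of the induced
    metric is the tangential part of the ambient derivative. *)
Lemma christoffel_coords l i j y : U y ->
  christoffel (induced_metric f) l i j y = coords (B y) (A y i j) l.
Proof.
move=> Uy; rewrite /christoffel mulr_sumr; apply: eq_bigr => q _.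
exact (first_kind_christoffel (invmx (induced_metric f y) l q)
  (hessian_comm j i Uy) (hessian_comm q i Uy) (hessian_comm q j Uy)
  (partial_metric i j q Uy) (partial_metric j i q Uy)
  (partial_metric q i j Uy)).
Qed.

Lemma second_ff_coords i j y : U y ->
  second_ff f i j y = A y i j - \sum_q coords (B y) (A y i j) q *: B y q.
Proof.
move=> Uy; congr (_ - _); rewrite exchange_big; apply: eq_bigr => q _.
rewrite -scaler_suml; congr (_ *: _); apply: eq_bigr => p _; congr (_ * _).
(* [normal_part] and [coords] contract the inverse metric in opposite index orders. *)
have gT : (induced_metric f y)^T = induced_metric f y.
  by apply/matrixP => a b; rewrite !mxE dotC.
by rewrite -[in LHS]gT -trmx_inv mxE.
Qed.

Lemma gauss_equation i j k l x : U x ->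
  riemann (induced_metric f) i j k l x =
  dot (second_ff f i k x) (second_ff f j l x)
  - dot (second_ff f j k x) (second_ff f i l x).
Proof.
move=> Ux; pose d i : 'rV[R]_n := delta_mx 0 i.
pose dc i q j l := 'D_(d i) (fun y => coords (B y) (A y j l) q : R^o) x.
have dchris a q b c :
    partial a (christoffel (induced_metric f) q b c : _ -> R^o) x
    = dc a q b c.
  apply: near_eq_derive; apply: filterS (nearU Ux) => y.
  exact: christoffel_coords.
pose T i j l := partial i (partial j (partial l f)) x.
(* Commutation of partial derivatives, applied to [partial c f] in place of [f]. *)
have TC a b c : T a b c = T b a c.
  exact (@partial_comm _ _ _ _ _ openU a b _ Ux (fun y Uy => diff2 c Uy)
    (fun e => diff3 e c Ux)).
have nearu : \forall y \near x, gram (B y) \in unitmx.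
  by apply: filterS (nearU Ux) => y /metric_unit.
have dcE a b c e := derive_gram_coords e nearu
  (fun q => @diff_derivable _ _ _ _ _ (d a) (diff2 q Ux))
  (@diff_derivable _ _ _ _ _ (d a) (diff3 b c Ux)).
have := gauss_algebra (metric_unit Ux) TC dcE i j k l.
rewrite !second_ff_coords // => <-; rewrite /riemann.
apply: eq_bigr => q _; congr (_ * _).
have cc l' i' j' := christoffel_coords l' i' j' Ux.
pose sub (a b : R) := a - b.
refine (f_equal2 +%R (f_equal2 sub (dchris i q j l) (dchris j q i l)) _).
apply: eq_bigr => p _.
exact (f_equal2 sub (f_equal2 *%R (cc p j l) (cc q i p))
  (f_equal2 *%R (cc p i l) (cc q j p))).
Qed.

End GaussEquation.

(** * Pinched curvature *)

Section PinchedForm.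
Context {R : realType} {n m : nat} (g : 'M[R]_n) (h : 'I_n -> 'I_n -> 'rV[R]_m).
Hypotheses (gsym : g^T = g)
  (gpos : forall x : 'rV[R]_n, x != 0 -> 0 < (x *m g *m x^T) 0 0)
  (hsym : forall i j, h i j = h j i).

Let comp c : 'M[R]_n := \matrix_(i, j) h i j 0 c.
Let H := \sum_(i < n) \sum_(j < n) invmx g i j *: h i j.
Let N := \sum_(i < n) \sum_(j < n) \sum_(k < n) \sum_(l < n)
  invmx g i k * invmx g j l * dot (h i j) (h k l).

Let csym c : (comp c)^T = comp c.
Proof. by apply/matrixP => i j; rewrite !mxE hsym. Qed.

Lemma trace_comp c : \tr (invmx g *m comp c) = H 0 c.
Proof.
rewrite /H summxE; apply: eq_bigr => i _; rewrite mxE summxE.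
by apply: eq_bigr => j _; rewrite !mxE hsym.
Qed.

(** By symmetry of [h] and of the inverse metric, the full contraction in [N] closes up into a
    cyclic product, which is a trace for each ambient component. *)
Lemma sqnorm_comp :
  N = \sum_c \tr (invmx g *m comp c *m (invmx g *m comp c)).
Proof.
transitivity (\sum_(i < n) \sum_(j < n) \sum_c
    (invmx g *m comp c) i j * (invmx g *m comp c) j i); last first.
  rewrite exchange_big /=.
  under eq_bigr => j _ do rewrite exchange_big /=.
  rewrite exchange_big /=; apply: eq_bigr => c _; apply: eq_bigr => j _.
  by rewrite mxE; apply: eq_bigr => i _; rewrite mulrC.
have isym i j : invmx g i j = invmx g j i.
  by rewrite -{1}gsym -trmx_inv mxE.
transitivity (\sum_(i < n) \sum_(l < n) \sum_(k < n) \sum_(j < n)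
  \sum_c (invmx g i k * h k l 0 c) * (invmx g l j * h j i 0 c)).
  apply: eq_bigr => i _; rewrite exchange_big [RHS]exchange_big /=.
  apply: eq_bigr => k _; rewrite [LHS]exchange_big /=.
  apply: eq_bigr => l _; apply: eq_bigr => j _.
  rewrite mulr_sumr; apply: eq_bigr => c _.
  by rewrite (isym l j) (hsym j i); ring.
apply: eq_bigr => i _; apply: eq_bigr => l _.
under eq_bigr => k _ do rewrite exchange_big /=.
rewrite exchange_big /=; apply: eq_bigr => c _.
rewrite !mxE mulr_suml; apply: eq_bigr => k _.
rewrite mulr_sumr; apply: eq_bigr => j _.
by rewrite !mxE.
Qed.

(** The ambient inner product is a sum over coordinates, and each coordinate contributes the 2 by 2
    minors of [comp c], which takes the place of the metric in [bivector_dot]. *)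
Lemma gauss_form_comp (w : 'M[R]_n) :
  \sum_(i < n) \sum_(j < n | (i < j)%N) \sum_(k < n) \sum_(l < n | (k < l)%N)
    w i j * w k l * (dot (h i k) (h j l) - dot (h j k) (h i l)) =
  \sum_c bivector_dot (comp c) w w.
Proof.
rewrite /bivector_dot [RHS]exchange_big /=; apply: eq_bigr => i _.
rewrite [RHS]exchange_big /=; apply: eq_bigr => j _.
rewrite [RHS]exchange_big /=; apply: eq_bigr => k _.
rewrite [RHS]exchange_big /=; apply: eq_bigr => l _.
rewrite -sumrB mulr_sumr; apply: eq_bigr => c _.
by rewrite !mxE; ring.
Qed.

Lemma gauss_form_pinching (eps : R) (w : 'M[R]_n) : (2 <= n)%N -> bivector w ->
  N - (n%:R - 1)^-1 * dot H H <= - eps * dot H H ->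
  eps / 2 * dot H H * bivector_dot g w w <=
  \sum_(i < n) \sum_(j < n | (i < j)%N) \sum_(k < n) \sum_(l < n | (k < l)%N)
    w i j * w k l * (dot (h i k) (h j l) - dot (h j k) (h i l)).
Proof.
move=> n2 bw hN; rewrite gauss_form_comp.
have b0 := bivector_dot_ge0 gsym gpos bw.
have key : (dot H H / (n%:R - 1) - N) * bivector_dot g w w <=
    2 * \sum_c bivector_dot (comp c) w w.
  have -> : dot H H / (n%:R - 1) - N = \sum_c
      ((\tr (invmx g *m comp c)) ^+ 2 / (n%:R - 1)
       - \tr (invmx g *m comp c *m (invmx g *m comp c))).
    rewrite sumrB sqnorm_comp; congr (_ - _); rewrite mulr_suml.
    by apply: eq_bigr => c _; rewrite trace_comp expr2.
  rewrite mulr_suml mulr_sumr; apply: ler_sum => c _.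
  exact (bivector_dot_pinching gsym gpos n2 (csym c) bw).
(* The pinching hypothesis is multiplied by the squared norm of [w], which is nonnegative, and
   chained with [key]; the factor 2 in [key] becomes the 1/2 of the bound. *)
have := ler_wpM2r b0 hN.
move: key.
move: (bivector_dot g w w) (\sum_c _) (dot H H) (n%:R - 1) => b s d q.
rewrite mulrBl [d / q]mulrC !mulrBl => h1 h2.
have -> : eps / 2 * d * b = 2^-1 * (eps * d * b) by ring.
by rewrite ler_pdivrMl; lra.
Qed.

End PinchedForm.

(** * Positivity of the induced metric, and the theorem for immersions *)

Lemma induced_metric_jacobian (R : realType) (n m : nat)
    (f : 'rV[R]_n -> 'rV[R]_m) (y : 'rV[R]_n) : differentiable f y ->
  induced_metric f y = jacobian f y *m (jacobian f y)^T.
Proof.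
move=> df; have row_jac i : partial i f y = row i (jacobian f y).
  by rewrite rowE; exact (deriveEjacobian (delta_mx 0 i) df).
apply/matrixP => i j; rewrite !mxE (row_jac i) (row_jac j).
by apply: eq_bigr => c _; rewrite !mxE.
Qed.

(** The value is the squared length of [x *m J], which is nonzero because [J] acts injectively on
    rows. *)
Lemma row_free_gram_gt0 (F : realFieldType) (n m : nat) (J : 'M[F]_(n, m))
    (x : 'rV[F]_n) : row_free J -> x != 0 -> 0 < (x *m (J *m J^T) *m x^T) 0 0.
Proof.
move=> fJ x0; rewrite mulmxA -mulmxA -trmx_mul mulmx_trE mxE eqxx mulr1n.
by apply: sqnorm_gt0; rewrite -(mul0mx _ J) (inj_eq (row_free_inj fJ)).
Qed.

Lemma gram_unitmx (F : realFieldType) (n m : nat) (J : 'M[F]_(n, m)) :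
  row_free J -> J *m J^T \in unitmx.
Proof.
move=> fJ; rewrite -row_free_unit; apply/inj_row_free => v vJ; apply/eqP.
apply: contraT => /(row_free_gram_gt0 fJ).
by rewrite vJ mul0mx mxE ltxx.
Qed.

Theorem lemma3p2 (R : realType) (n k : nat) (hn : (2 <= n)%N) (hk : (1 <= k)%N)
    (M : smooth_manifold R n) (F : M -> 'rV[R]_(n + k)) (hF : immersion F)
    (eps : R) (heps : 0 < eps)
    (hpinch : forall (p : M) (a : chart M), chart_dom a p ->
       let f := F \o chart_param a in
       let x := chart_coord a p in
       let H := mean_curvature f x in
       second_ff_sqnorm f x - (n%:R - 1)^-1 * dot H H <= - eps * dot H H) :
  forall (p : M) (a : chart M), chart_dom a p ->
    let f := F \o chart_param a in
    let x := chart_coord a p in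
    let g := induced_metric f in
    let H := mean_curvature f x in
    forall w : 'M[R]_n, bivector w ->
      eps / 2 * dot H H * bivector_dot (g x) w w
        <= curvature_operator g x w w.
Proof.
move=> p a ap f x g H w bw; have [sm free] := hF a.
pose U := chart_image a; have openU : open U by exact: coord_image_open.
have Ux : U x by exists p.
(* Order 3 is what makes the second partial derivatives differentiable, as the derivatives of the
   Christoffel symbols require. *)
have [d1 s1] := sm 3; have d2 i := (s1 i).1; have d3 i j := ((s1 j).2 i).1.
have gE y (Uy : U y) := induced_metric_jacobian (d1 y Uy).
have gu y : U y -> g y \in unitmx.
  by move=> Uy; rewrite /g (gE y Uy); exact (gram_unitmx (free y Uy)).
have gsym : (g x)^T = g x by apply/matrixP => i j; rewrite !mxE dotC.
have gpos (v : 'rV[R]_n) : v != 0 -> 0 < (v *m g x *m v^T) 0 0.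
  by rewrite /g (gE x Ux); exact (row_free_gram_gt0 (free x Ux)).
have hsym i j : second_ff f i j x = second_ff f j i x.
  (* The Hessian is symmetric, and the normal projection preserves this. *)
  exact (f_equal (normal_part f x) (hessian_comm openU d1 d2 i j Ux)).
have -> : curvature_operator g x w w =
    \sum_(i < n) \sum_(j < n | (i < j)%N) \sum_(k < n) \sum_(l < n | (k < l)%N)
      w i j * w k l * (dot (second_ff f i k x) (second_ff f j l x)
                       - dot (second_ff f j k x) (second_ff f i l x)).
  apply: eq_bigr => i _; apply: eq_bigr => j _.
  apply: eq_bigr => q _; apply: eq_bigr => l _.
  exact (f_equal _ (gauss_equation openU d1 d2 d3 gu i j q l Ux)).
exact (gauss_form_pinching gsym gpos hsym hn bw (hpinch p a ap)).
Qed.
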